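(* Let $A\in\mathbb{M}_n^+$ and let $N\in\mathbb{M}_m$ be normal. Then, for all positive linear, sub-unital maps $\Phi:\mathbb{M}_m\to\mathbb{M}_n$ and all $p\ge1$, $$|A\Phi(N)A|^p\prec_{w\log}A^p\Phi(|N|^p)A^p.$$
   Context: $\mathbb{M}_n$ is the space of $n\times n$ complex matrices, $\mathbb{M}_n^+$ its positive semidefinite part, $I$ the identity matrix, and $|X|=(X^*X)^{1/2}$. A linear map $\Phi:\mathbb{M}_m\to\mathbb{M}_n$ is positive if $\Phi(\mathbb{M}_m^+)\subset\mathbb{M}_n^+$, and sub-unital if $\Phi(I)\le I$ (Loewner order). For $S,T\in\mathbb{M}_n^+$, $S\prec_{w\log}T$ means $\prod_{j=1}^k\lambda_j(S)\le\prod_{j=1}^k\lambda_j(T)$ for every $k=1,\ldots,n$, where $\lambda_1(\cdot)\ge\cdots\ge\lambda_n(\cdot)$ are the eigenvalues arranged in decreasing order (with multiplicity). *)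

(* Defs.v *)
From mathcomp Require Import all_boot all_order all_algebra.
From mathcomp Require Import spectral complex.
From mathcomp Require Import reals exp.

Set Implicit Arguments.
Unset Strict Implicit.
Unset Printing Implicit Defensive.

Import Order.TTheory GRing.Theory Num.Theory.

Local Open Scope ring_scope.
Local Open Scope sesquilinear_scope.
Local Open Scope complex_scope.

Section Defs.
Context {R : realType}.
Local Notation C := R[i].

(* In R[i], 0 <= z means that z is real and nonnegative. *)
Definition psdmx n (A : 'M[C]_n) : Prop :=
  A \is hermsymmx /\ forall x : 'cV[C]_n, 0 <= (x^t* *m A *m x) 0 0.

Definition loewner_le n (A B : 'M[C]_n) : Prop := psdmx (B - A).

(* The power A^r by functional calculus, meant for positive semidefinite A:
   if A = U^* diag(d) U with U unitary, then A^r = U^* diag(d^r) U.  The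
   entries of d are then real, and powR gives 0 `^ r = 0 for r != 0. *)
Definition psdpow n (A : 'M[C]_n) (r : R) : 'M[C]_n :=
  let U := spectralmx A in
  invmx U *m
  diag_mx (map_mx (fun z : C => (powR (complex.Re z) r)%:C) (spectral_diag A))
  *m U.

Definition absmx n (X : 'M[C]_n) : 'M[C]_n := psdpow (X^t* *m X) 2^-1.

(* The roots of the characteristic polynomial, with multiplicity. *)
Definition eigenvalues n (A : 'M[C]_n) : seq C :=
  sval (closed_field_poly_normal (char_poly A)).

(* The eigenvalues in decreasing order, indexed from 0, for a matrix whose
   eigenvalues are real. *)
Definition lambda n (A : 'M[C]_n) (j : nat) : R :=
  nth 0 (sort >=%R [seq complex.Re z | z <- eigenvalues A]) j.

Definition wlogmaj n (S T : 'M[C]_n) : Prop :=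
  forall k : nat, (1 <= k <= n)%N ->
    \prod_(j < k) lambda S j <= \prod_(j < k) lambda T j.

Definition positive_map m n (Phi : 'M[C]_m -> 'M[C]_n) : Prop :=
  forall X, psdmx X -> psdmx (Phi X).

Definition subunital m n (Phi : 'M[C]_m -> 'M[C]_n) : Prop :=
  loewner_le (Phi 1%:M) 1%:M.

End Defs.

(* Main.v *)
(** For a normal [N] with spectral projections [P_i] and eigenvalues [d_i], the
    maps [e |-> sum_i e_i Phi(P_i)] send positive 2x2 weights to positive block
    matrices.  Hence [[B_s, B_h], [B_h, B_t]] >= 0 for [B_t = Phi(|N|^t)] and
    [2h = s + t], and [[B_1, Phi(N)], [Phi(N)^*, B_1]] >= 0.

    Products of the [k] largest eigenvalues are reached through determinants:
    [det(Y^* T Y) <= lambda_1(T) ... lambda_k(T) det(Y^* Y)] for [T >= 0] and an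
    n x k matrix [Y], while a positive block [[X, Y], [Y^*, Z]] satisfies
    [|det Y|^2 <= det X det Z].  Writing
      [F(t) = lambda_1 ... lambda_k (A^t Phi(|N|^t) A^t)],
    the two facts give [lambda_1 ... lambda_k (|A Phi(N) A|) <= F(1)] and the
    midpoint log-convexity [F(h)^2 <= F(s) F(t)].  As [F(0) <= 1] by
    sub-unitality and [F] is bounded on [0, p], [F(1)^p <= F(p)].  This replaces
    both the Araki inequality and Jensen's operator inequality. *)

Require Import Defs.
From mathcomp Require Import all_boot all_order all_algebra.
From mathcomp Require Import perm spectral complex.
From mathcomp Require Import reals exp.
From mathcomp Require Import ring lra.

Set Implicit Arguments.
Unset Strict Implicit.
Unset Printing Implicit Defensive.

Import Order.TTheory GRing.Theory Num.Theory.

Local Open Scope ring_scope.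
Local Open Scope sesquilinear_scope.
Local Open Scope complex_scope.

(** * Adjoints and positive semidefinite matrices *)

Section Adjoint.
Variable C : numClosedFieldType.

Lemma adjmxM m n p (A : 'M[C]_(m, n)) (B : 'M[C]_(n, p)) :
  (A *m B)^t* = B^t* *m A^t*.
Proof. by rewrite trmx_mul map_mxM. Qed.

Lemma adjmxD m n (A B : 'M[C]_(m, n)) : (A + B)^t* = A^t* + B^t*.
Proof. by rewrite linearD /= map_mxD. Qed.

Lemma adjmxN m n (A : 'M[C]_(m, n)) : (- A)^t* = - A^t*.
Proof. by rewrite linearN /= map_mxN. Qed.

Lemma adjmxZ m n a (A : 'M[C]_(m, n)) : (a *: A)^t* = Num.conj a *: A^t*.
Proof. by rewrite linearZ /= map_mxZ. Qed.

Lemma adjmx1 n : (1%:M : 'M[C]_n)^t* = 1%:M.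
Proof. by rewrite trmx1 map_mx1. Qed.

Lemma adjmx_diag n (d : 'rV[C]_n) : (diag_mx d)^t* =
  diag_mx (map_mx Num.conj d).
Proof. by rewrite tr_diag_mx map_diag_mx. Qed.

Lemma det_adjmx n (A : 'M[C]_n) : \det (A^t*) = Num.conj (\det A).
Proof. by rewrite det_map_mx det_tr. Qed.

Lemma gram_ge0 n (x : 'cV[C]_n) : 0 <= (x^t* *m x) 0 0.
Proof.
by rewrite mxE sumr_ge0 // => i _; rewrite !mxE mulrC -normCK exprn_ge0.
Qed.

Lemma gram_eq0 n (x : 'cV[C]_n) : (x^t* *m x) 0 0 = 0 -> x = 0.
Proof.
rewrite mxE => /eqP; rewrite psumr_eq0; last first.
  by move=> i _; rewrite !mxE mulrC -normCK exprn_ge0.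
move=> /allP h; apply/matrixP => i j; rewrite ord1 mxE.
have := h i (mem_index_enum i); rewrite /= !mxE mulrC -normCK expf_eq0 /=.
by rewrite normr_eq0 => /eqP.
Qed.

Lemma unitarymx_adjK n (U : 'M[C]_n) : U \is unitarymx -> U^t* *m U = 1%:M.
Proof. by move/unitarymxP/mulmx1C. Qed.

(** Evaluates a diagonalised matrix on its eigenvectors: for [x] a basis vector, the form at [U^* x]
    is a diagonal entry of [D]. *)
Lemma unitarymx_form n k (U D : 'M[C]_n) (x : 'M[C]_(n, k)) : U \is unitarymx ->
  (U^t* *m x)^t* *m (U^t* *m D *m U) *m (U^t* *m x) = x^t* *m D *m x.
Proof.
move=> uU; rewrite adjmxM trmxCK -!mulmxA !(mulmxA U) (unitarymxP uU).
by rewrite !mul1mx.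
Qed.

Lemma det0_colP n (A : 'M[C]_n) :
  reflect (exists2 v : 'cV_n, v != 0 & A *m v = 0) (\det A == 0).
Proof.
rewrite -det_tr; apply: (iffP det0P) => -[v v0 vA]; exists v^T.
- by rewrite trmx_eq0.
- by apply: trmx_inj; rewrite trmx_mul trmxK vA trmx0.
- by rewrite trmx_eq0.
- by rewrite -trmx_mul vA trmx0.
Qed.

Lemma det0_col n (A : 'M[C]_n) (v : 'cV_n) : v != 0 -> A *m v = 0 -> \det A = 0.
Proof. by move=> v0 Av; apply/eqP/det0_colP; exists v. Qed.

End Adjoint.

Section Psd.
Variable R : realType.
Local Notation C := R[i].

Lemma psdmx_adj n (A : 'M[C]_n) : psdmx A -> A^t* = A.
Proof. by case=> /is_hermitianmxP; rewrite expr0 scale1r => /esym. Qed.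

Lemma psdmxI n (A : 'M[C]_n) : A^t* = A ->
  (forall x : 'cV[C]_n, 0 <= (x^t* *m A *m x) 0 0) -> psdmx A.
Proof. by move=> h ?; split=> //; apply/is_hermitianmxP;
  rewrite expr0 scale1r. Qed.

Lemma psdmx_ge0 n (A : 'M[C]_n) (x : 'cV[C]_n) :
  psdmx A -> 0 <= (x^t* *m A *m x) 0 0.
Proof. by case. Qed.

Lemma psdmx_congr n k (A : 'M[C]_n) (B : 'M[C]_(n, k)) :
  psdmx A -> psdmx (B^t* *m A *m B).
Proof.
move=> hA; apply: psdmxI => [|x].
  by rewrite !adjmxM trmxCK (psdmx_adj hA) mulmxA.
by have := psdmx_ge0 (B *m x) hA; rewrite adjmxM !mulmxA.
Qed.

Lemma psdmx_gram m n (B : 'M[C]_(m, n)) : psdmx (B^t* *m B).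
Proof.
apply: psdmxI => [|x]; first by rewrite adjmxM trmxCK.
by have := gram_ge0 (B *m x); rewrite adjmxM !mulmxA.
Qed.

Lemma psdmxD n (A B : 'M[C]_n) : psdmx A -> psdmx B -> psdmx (A + B).
Proof.
move=> hA hB; apply: psdmxI => [|x].
  by rewrite adjmxD !psdmx_adj.
by rewrite mulmxDr mulmxDl mxE addr_ge0 // psdmx_ge0.
Qed.

Lemma psdmxZ n a (A : 'M[C]_n) : 0 <= a -> psdmx A -> psdmx (a *: A).
Proof.
move=> a0 hA; apply: psdmxI => [|x].
  by rewrite adjmxZ psdmx_adj // geC0_conj.
by rewrite -scalemxAr -scalemxAl mxE mulr_ge0 // psdmx_ge0.
Qed.

Lemma psdmx0 n : psdmx (0 : 'M[C]_n).
Proof. by have := psdmx_gram (0 : 'M[C]_n); rewrite mulmx0. Qed.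

Lemma psdmx_sum (I : finType) n (F : I -> 'M[C]_n) :
  (forall i, psdmx (F i)) -> psdmx (\sum_i F i).
Proof. by move=> h; apply: (big_ind (@psdmx R n) (psdmx0 n) (@psdmxD n)). Qed.

Lemma loewner_le_trans n (B A D : 'M[C]_n) :
  loewner_le A B -> loewner_le B D -> loewner_le A D.
Proof.
rewrite /loewner_le => h1 h2; rewrite (_ : D - A = (B - A) + (D - B)).
  exact: psdmxD.
by rewrite [RHS]addrC addrA subrK.
Qed.

Lemma loewner_le_congr n k (A B : 'M[C]_n) (Y : 'M[C]_(n, k)) :
  loewner_le A B -> loewner_le (Y^t* *m A *m Y) (Y^t* *m B *m Y).
Proof.
by rewrite /loewner_le => h; rewrite -mulmxBl -mulmxBr; apply: psdmx_congr.
Qed.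

Lemma loewner_leD n (A B A' B' : 'M[C]_n) :
  loewner_le A B -> loewner_le A' B' -> loewner_le (A + A') (B + B').
Proof.
by rewrite /loewner_le => h h'; have := psdmxD h h'; rewrite addrACA -opprD.
Qed.

Lemma loewner_leZ n a (A B : 'M[C]_n) : 0 <= a ->
  loewner_le A B -> loewner_le (a *: A) (a *: B).
Proof. by rewrite /loewner_le => h h'; rewrite -scalerBr; apply: psdmxZ. Qed.

(** The entries are real so that they can be compared and raised to real powers; they form a
    function rather than a row so that pointwise identities rewrite through [eq_rdiag]. *)
Definition rdiag n (d : 'I_n -> R) : 'M[C]_n := diag_mx (\row_i (d i)%:C).

Lemma eq_rdiag n (d e : 'I_n -> R) : d =1 e -> rdiag d = rdiag e.
Proof.
by move=> h; rewrite /rdiag; congr diag_mx; apply/rowP => i; rewrite !mxE h.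
Qed.

Lemma rdiag_adj n (d : 'I_n -> R) : (rdiag d)^t* = rdiag d.
Proof.
rewrite /rdiag adjmx_diag; congr diag_mx; apply/rowP => i; rewrite !mxE.
exact: conjc_real.
Qed.

Lemma rdiagM n (d e : 'I_n -> R) : 
  rdiag d *m rdiag e = rdiag (fun i => d i * e i).
Proof.
rewrite /rdiag mulmx_diag; congr diag_mx; apply/rowP => i; rewrite !mxE.
by rewrite rmorphM.
Qed.

Lemma rdiag_cst n a : rdiag (fun=> a : R) = (a%:C)%:M :> 'M[C]_n.
Proof.
by rewrite -diag_const_mx; congr diag_mx; apply/rowP => i; rewrite !mxE.
Qed.

Lemma rdiagB n (d e : 'I_n -> R) : 
  rdiag d - rdiag e = rdiag (fun i => d i - e i).
Proof. by apply/matrixP => i j; rewrite !mxE -mulrnBl rmorphB. Qed.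

Lemma det_rdiag n (d : 'I_n -> R) : \det (rdiag d) = (\prod_i d i)%:C.
Proof. by rewrite det_diag rmorph_prod; apply: eq_bigr => i _; rewrite mxE. Qed.

Lemma rdiag_ge0 n (d : 'I_n -> R) : (forall i, 0 <= d i) -> psdmx (rdiag d).
Proof.
move=> d0; pose G : 'M[C]_n := rdiag (fun i => Num.sqrt (d i)).
have -> : rdiag d = G^t* *m G.
  rewrite rdiag_adj rdiagM; apply: eq_rdiag => i.
  by rewrite -expr2 sqr_sqrtr.
exact: psdmx_gram.
Qed.

Lemma rdiag_le n (d e : 'I_n -> R) : (forall i, d i <= e i) ->
  loewner_le (rdiag d) (rdiag e).
Proof.
by move=> h; rewrite /loewner_le rdiagB; apply: rdiag_ge0 => i; rewrite subr_ge0.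
Qed.

Lemma rdiag_delta n (d : 'I_n -> R) i :
  let x : 'cV[C]_n := delta_mx i 0 in (x^t* *m rdiag d *m x) 0 0 = (d i)%:C.
Proof.
move=> x; rewrite /x {x}.
rewrite mul_mx_diag mxE (bigD1 i) //= big1 ?addr0 => [|j ji].
  by rewrite !mxE !eqxx mulr1 rmorph1 mul1r.
by rewrite !mxE (negPf ji) mulr0.
Qed.

Lemma psdmx_spectral n (A : 'M[C]_n) : psdmx A ->
  exists2 U : 'M[C]_n, U \is unitarymx & exists2 d : 'I_n -> R,
    forall i, 0 <= d i & A = U^t* *m rdiag d *m U.
Proof.
move=> hA; have hh : A \is hermsymmx by case: hA.
have /orthomx_spectralP := hermitian_normalmx hh.
have uU := spectral_unitarymx A; set U := spectralmx A in uU *.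
rewrite invmx_unitary // => eA.
have sr := hermitian_spectral_diag_real hh.
pose d i := complex.Re (spectral_diag A 0 i).
have ed : diag_mx (spectral_diag A) = rdiag d.
  congr diag_mx; apply/rowP => i; rewrite mxE.
  by have /mxOverP/(_ 0 i) /RRe_real := sr.
exists U => //; exists d; last by rewrite -ed.
(* [d i] is the value of the form of [A] at the eigenvector [U^* e_i]. *)
move=> i; rewrite -lecR -(rdiag_delta d) -ed.
by have := psdmx_ge0 (U^t* *m delta_mx i 0) hA; rewrite {1}eA unitarymx_form.
Qed.

Lemma psdmx_sqrt n (A : 'M[C]_n) : psdmx A -> exists G : 'M[C]_n, A = G^t* *m G.
Proof.
case/psdmx_spectral => U uU [d d0 ->].
exists (rdiag (fun i => Num.sqrt (d i)) *m U).
rewrite adjmxM rdiag_adj !mulmxA -(mulmxA _ (rdiag _) (rdiag _)) rdiagM.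
by congr (_ *m _ *m _); apply: eq_rdiag => i; rewrite -expr2 sqr_sqrtr.
Qed.

(** With [A = G^* G], the form at [x] is the squared norm of [G x]. *)
Lemma psdmx_ker n (A : 'M[C]_n) (x : 'cV[C]_n) : psdmx A ->
  (x^t* *m A *m x) 0 0 = 0 -> A *m x = 0.
Proof.
case/psdmx_sqrt => G ->; rewrite !mulmxA -adjmxM -mulmxA => /gram_eq0 h.
by rewrite -mulmxA h mulmx0.
Qed.

Lemma det_psdmx_ge0 n (A : 'M[C]_n) : psdmx A -> 0 <= \det A.
Proof.
case/psdmx_sqrt => G ->; rewrite det_mulmx det_adjmx mulrC -normCK.
exact: exprn_ge0.
Qed.

Lemma det_psdmx_le1 n (A : 'M[C]_n) : psdmx A -> loewner_le A 1%:M ->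
  \det A <= 1.
Proof.
move=> hA; case/psdmx_spectral: (hA) => U uU [d d0 ->] h1.
have d1 i : d i <= 1.
  have := psdmx_ge0 (U^t* *m delta_mx i 0) h1.
  have -> : 1%:M - U^t* *m rdiag d *m U =
            U^t* *m (rdiag (fun j => 1 - d j)) *m U.
    by rewrite -rdiagB rdiag_cst mulmxBr mulmxBl mulmx1 unitarymx_adjK.
  by rewrite unitarymx_form // rdiag_delta lecR subr_ge0.
rewrite !det_mulmx mulrC mulrA -det_mulmx (unitarymxP uU) det1 mul1r det_rdiag.
suff: \prod_i d i <= 1 by rewrite -lecR.
by apply: prodr_ile1 => i; rewrite d0 d1.
Qed.

(** If [T] is singular, positivity of [T - S] puts a kernel vector of [T] into the kernel of [S],
    and both determinants vanish. Otherwise [T = G^* G] with [G] invertible, and congruence by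
    [G^-1] reduces the claim to [T = 1]. *)
Lemma loewner_le_det n (S T : 'M[C]_n) : psdmx S -> loewner_le S T ->
  \det S <= \det T.
Proof.
move=> hS hST.
have hT : psdmx T by rewrite -(subrK S T); apply: psdmxD.
have [T0|T0] := eqVneq (\det T) 0.
  have /det0_colP [v v0 Tv] := introT eqP T0.
  suff Sv : S *m v = 0 by rewrite T0 (det0_col v0 Sv).
  apply: psdmx_ker => //.
  apply/eqP; rewrite eq_le psdmx_ge0 // andbT.
  have := psdmx_ge0 v hST; rewrite mulmxBr mulmxBl mxE -mulmxA Tv mulmx0.
  by rewrite mxE add0r mxE oppr_ge0.
case/psdmx_sqrt: (hT) => G eT.
have uG : G \in unitmx.
  rewrite unitmxE unitfE; apply: contraNneq T0.
  by rewrite eT det_mulmx => ->; rewrite mulr0.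
pose S' := (invmx G)^t* *m S *m invmx G.
have eG : G^t* *m (invmx G)^t* = 1%:M by rewrite -adjmxM mulVmx // adjmx1.
have eS : S = G^t* *m S' *m G.
  by rewrite /S' !mulmxA eG mul1mx mulmxKV.
have h1 : \det S' <= 1.
  apply: det_psdmx_le1; first exact: psdmx_congr.
  have := loewner_le_congr (invmx G) hST.
  by rewrite eT mulmxA (mulmx1C eG) mul1mx mulmxV.
clearbody S'; rewrite eS eT !det_mulmx det_adjmx.
rewrite mulrAC -[X in _ <= X]mulr1 ler_wpM2l //.
by rewrite mulrC -normCK exprn_ge0.
Qed.

End Psd.

(** * Ordered eigenvalues *)

Lemma char_poly_similar (F : comNzRingType) n (V D U : 'M[F]_n) :
  V *m U = 1%:M -> char_poly (V *m D *m U) = char_poly D.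
Proof.
move=> VU; rewrite /char_poly /char_poly_mx !map_mxM /=.
have VU' : map_mx polyC V *m map_mx polyC U = 1%:M.
  by rewrite -map_mxM VU map_mx1.
have eX : 'X%:M = map_mx polyC V *m 'X%:M *m map_mx polyC U.
  by rewrite scalar_mxC -mulmxA VU' mulmx1.
rewrite {1}eX -mulmxBl -mulmxBr !det_mulmx mulrC mulrA -det_mulmx.
by rewrite (mulmx1C VU') det1 mul1r.
Qed.

Section Lambda.
Variable R : realType.
Local Notation C := R[i].

(** Comparing roots of the characteristic polynomial, the eigenvalues are the [d i] up to order; as
    [d] is already nonincreasing, sorting yields exactly [d]. *)
Lemma lambda_rdiag n (U : 'M[C]_n) (d : 'I_n -> R) (j : 'I_n) :
  U \is unitarymx -> (forall i i' : 'I_n, (i <= i')%N -> d i' <= d i) ->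
  lambda (U^t* *m rdiag d *m U) j = d j.
Proof.
move=> uU dd; rewrite /lambda.
set A := _ *m U.
have pA : char_poly A =
          \prod_(z <- [seq (d i)%:C | i <- enum 'I_n]) ('X - z%:P).
  rewrite char_poly_similar ?unitarymx_adjK // char_poly_trig.
    by rewrite big_map big_enum; apply: eq_bigr => i _; rewrite !mxE eqxx.
  by apply: diag_mx_is_trig.
have pe : perm_eq (eigenvalues A) [seq (d i)%:C | i <- enum 'I_n].
  apply: prod_XsubC_eq; rewrite -pA /eigenvalues.
  case: closed_field_poly_normal => s /= ->.
  by rewrite (monicP (char_poly_monic A)) scale1r.
have {}pe : perm_eq [seq complex.Re z | z <- eigenvalues A]
                    [seq d i | i <- enum 'I_n].
  by have := perm_map (@complex.Re R) pe; rewrite -map_comp.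
have -> : sort >=%R [seq complex.Re z | z <- eigenvalues A] =
  [seq d i | i <- enum 'I_n].
  apply: (@sorted_eq _ >=%R).
  - exact: ge_trans.
  - by move=> x y; rewrite andbC => /le_anti.
  - by apply: sort_sorted => x y; exact: le_total.
  - rewrite sorted_map.
    have := iota_sorted 0 n; rewrite -val_enum_ord sorted_map.
    by apply: sub_sorted => x y; apply: dd.
  - by rewrite perm_sort.
by rewrite (nth_map j) ?size_enum_ord // nth_ord_enum.
Qed.

Lemma nonincreasing_perm n (d : 'I_n -> R) : exists s : 'S_n,
  forall i i' : 'I_n, (i <= i')%N -> d (s i') <= d (s i).
Proof.
pose t := sort >=%R [tuple d i | i < n].
have st : size t == n by rewrite size_sort size_tuple.
have : perm_eq (Tuple st) [tuple d i | i < n] by rewrite perm_sort.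
case/tuple_permP => s es; exists s => i i' ii'.
have nt (l : 'I_n) : nth 0 t l = d (s l).
  by rewrite -[t]/(tval (Tuple st)) es -tnth_nth !tnth_mktuple.
rewrite -!nt; apply: (@sorted_leq_nth _ >=%R) => //.
- exact: ge_trans.
- exact: lexx.
- by apply: sort_sorted => x y; exact: le_total.
- by rewrite inE (eqP st).
- by rewrite inE (eqP st).
Qed.

(** Links the sorted list of roots behind [lambda] to a unitary diagonalisation: permuting the rows
    of [U] sorts the diagonal. *)
Lemma psdmx_lambda n (A : 'M[C]_n) : psdmx A ->
  exists2 U : 'M[C]_n, U \is unitarymx &
    [/\ A = U^t* *m rdiag (fun i => lambda A i) *m U,
        forall i : 'I_n, 0 <= lambda A i &
        forall i i' : 'I_n, (i <= i')%N -> lambda A i' <= lambda A i].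
Proof.
case/psdmx_spectral => U uU [d d0 eA].
have [s ds] := nonincreasing_perm d.
have uV : row_perm s U \is unitarymx.
  apply/unitarymxP/matrixP => i j.
  have /unitarymxP/matrixP/(_ (s i) (s j)) := uU.
  rewrite !mxE (inj_eq perm_inj) => <-.
  by apply: eq_bigr => l _; rewrite !mxE.
have {}eA : A = (row_perm s U)^t* *m rdiag (d \o s) *m row_perm s U.
  rewrite eA !mul_mx_diag; apply/matrixP => i j; rewrite !mxE.
  rewrite (reindex_inj (@perm_inj _ s)); apply: eq_bigr => l _.
  by rewrite !mxE.
have el (i : 'I_n) : lambda A i = d (s i).
  by rewrite eA lambda_rdiag.
exists (row_perm s U) => //; split.
- by rewrite [LHS]eA (eq_rdiag el).
- by move=> i; rewrite el.
- by move=> i i'; rewrite !el; apply: ds.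
Qed.

End Lambda.

(** * Positive 2x2 block matrices *)

Section Psd2.
Variable C : numClosedFieldType.

(* The block matrix [[X, Y], [Y^*, Z]] is positive, as a quadratic form. *)
Definition psdmx2 n (X Y Z : 'M[C]_n) := forall x y : 'cV[C]_n,
  0 <= (x^t* *m X *m x + x^t* *m Y *m y + y^t* *m Y^t* *m x
        + y^t* *m Z *m y) 0 0.

Lemma psdmx2_congr n k (X Y Z : 'M[C]_n) (U V : 'M[C]_(n, k)) :
  psdmx2 X Y Z ->
  psdmx2 (U^t* *m X *m U) (U^t* *m Y *m V) (V^t* *m Z *m V).
Proof.
move=> h x y; have := h (U *m x) (V *m y).
by rewrite !adjmxM !trmxCK !mulmxA.
Qed.

Lemma psdmx2D n (X Y Z X' Y' Z' : 'M[C]_n) :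
  psdmx2 X Y Z -> psdmx2 X' Y' Z' -> psdmx2 (X + X') (Y + Y') (Z + Z').
Proof.
move=> h h' x y; have := addr_ge0 (h x y) (h' x y).
rewrite adjmxD !mulmxDr !mulmxDl !mxE; set t := (X in 0 <= X -> _).
by move=> t0; set s := (X in 0 <= X); have -> : s = t by rewrite /s /t; ring.
Qed.

Lemma psdmx2_sum (I : finType) n (F G H : I -> 'M[C]_n) :
  (forall i, psdmx2 (F i) (G i) (H i)) ->
  psdmx2 (\sum_i F i) (\sum_i G i) (\sum_i H i).
Proof.
move=> h; elim/big_rec3: _ => [x y|i X Y Z _]; last exact: psdmx2D.
by rewrite trmx0 map_mx0 !mulmx0 !mul0mx !addr0 mxE.
Qed.

(** The block form at the pair [x], [y] is the form of [K] at [a x + b y]. *)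
Lemma psdmx2_scale n (K : 'M[C]_n) (a b : C) : K^t* = K ->
  (forall x : 'cV[C]_n, 0 <= (x^t* *m K *m x) 0 0) ->
  psdmx2 ((`|a| ^+ 2) *: K) ((Num.conj a * b) *: K) ((`|b| ^+ 2) *: K).
Proof.
move=> aK hK x y; have := hK (a *: x + b *: y).
rewrite !adjmxD !adjmxZ aK !normCK.
rewrite !mulmxDl !mulmxDr -!scalemxAr -!scalemxAl !scalerA !mxE.
rewrite (rmorphM Num.conj) /= conjCK; set t := (X in 0 <= X -> _).
by move=> t0; set s := (X in 0 <= X); have -> : s = t by rewrite /s /t; ring.
Qed.

(** Put [w = Y v], [g = w^* w] and [q = w^* X w]. Since [Z v = 0], the block form at the pair
    [- e w], [v] is [e (e q - 2 g)], which is negative for small [e > 0] unless [g = 0]. *)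
Lemma psdmx2_ker n (X Y Z : 'M[C]_n) (v : 'cV[C]_n) : psdmx2 X Y Z ->
  Z *m v = 0 -> Y *m v = 0.
Proof.
move=> h Zv; apply: gram_eq0; set w := Y *m v; set g := _ 0 0.
have g0 : 0 <= g by apply: gram_ge0.
have := h w 0; rewrite trmx0 map_mx0 !mulmx0 !mul0mx !addr0;
  set q := _ 0 0 => q0.
(* Small enough, as [e q <= g]; the summand 1 keeps the denominator positive when [q = 0]. *)
pose e := g / (q + 1).
have q1 : 0 < q + 1 by rewrite ltr_wpDl.
have e0 : 0 <= e by rewrite divr_ge0 // ltW.
have := h ((- e) *: w) v.
rewrite -(mulmxA _ Z) Zv mulmx0 addr0 -(adjmxM Y) -(mulmxA _ Y) -/w.
rewrite adjmxZ -!scalemxAr -!scalemxAl (rmorphN Num.conj) /= geC0_conj //.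
have eD (A B : 'M[C]_1) : (A + B) 0 0 = A 0 0 + B 0 0 by rewrite mxE.
have eZ c (A : 'M[C]_1) : (c *: A) 0 0 = c * A 0 0 by rewrite mxE.
rewrite !eD !eZ -/q -/g => hh; have [//|gn0] := eqVneq g 0.
have gp : 0 < g by rewrite lt_def gn0.
have ep : 0 < e by rewrite divr_gt0.
have : 0 <= e * (e * q - 2 * g).
  by move: hh; congr (_ <= _); ring.
rewrite pmulr_rge0 // subr_ge0 /e => hle.
have : g * (2 * (q + 1)) <= g * q.
  have := ler_wpM2r (ltW q1) hle.
  by congr (_ <= _); [ring | rewrite mulrAC divfK ?gt_eqF].
rewrite ler_pM2l // => {}hle.
have : q < 2 * (q + 1).
  rewrite mulrDr mulr1 -subr_gt0.
  have -> : 2 * q + 2 - q = q + 1 + 1 by ring.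
  by rewrite addr_gt0.
by move/(le_lt_trans hle); rewrite ltxx.
Qed.

End Psd2.

Section Psd2Det.
Variable R : realType.
Local Notation C := R[i].

(** Schur complement: the block form at [x] and [- Z^-1 Y^* x] gives [Y Z^-1 Y^* <= X], and the
    determinant is monotone. If [Z] is singular, its kernel lies in that of [Y], so [det Y = 0]. *)
Lemma psdmx2_det n (X Y Z : 'M[C]_n) : psdmx X -> psdmx Z -> psdmx2 X Y Z ->
  `|\det Y| ^+ 2 <= \det X * \det Z.
Proof.
move=> hX hZ h.
have [Z0|Z0] := eqVneq (\det Z) 0.
  rewrite Z0 mulr0; have /det0_colP [v v0 Zv] := introT eqP Z0.
  suff: Y *m v = 0.
    by move/(det0_col v0) ->; rewrite normr0 expr0n.
  exact: psdmx2_ker h Zv.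
have uZ : Z \in unitmx by rewrite unitmxE unitfE.
have aZi : (invmx Z)^t* = invmx Z.
  have h1 : (invmx Z)^t* *m Z = 1%:M.
    by rewrite -{2}(psdmx_adj hZ) -adjmxM mulmxV // adjmx1.
  by rewrite -[LHS]mulmx1 -(mulmxV uZ) mulmxA h1 mul1mx.
set S := Y *m invmx Z *m Y^t*.
have aS : S^t* = S by rewrite /S !adjmxM trmxCK aZi mulmxA.
have le : loewner_le S X.
  apply: psdmxI => [|x]; first by rewrite adjmxD adjmxN aS (psdmx_adj hX).
  have := h x (- (invmx Z *m Y^t* *m x)).
  rewrite adjmxN !adjmxM trmxCK aZi !mulmxN !mulNmx opprK !mulmxA.
  by rewrite mulmxKV // subrK mulmxBr mulmxBl /S !mulmxA.
have hS : psdmx S.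
  have -> : S = (invmx Z *m Y^t* )^t* *m Z *m (invmx Z *m Y^t* ).
    by rewrite adjmxM trmxCK aZi !mulmxA mulmxKV.
  exact: psdmx_congr.
have := loewner_le_det hS le.
rewrite /S !det_mulmx det_adjmx det_inv mulrAC -normCK ler_pdivrMr //.
by rewrite lt_def Z0 det_psdmx_ge0.
Qed.

End Psd2Det.

(** * Determinants of compressions *)

(** Sylvester's determinant identity, from two triangular reductions of the block matrix [B]. The
    case [a = 0] is separate because [a ^+ k] is cancelled at the end. *)
Lemma det_scalarD_mulC (F : idomainType) k (a : F) (X Y : 'M[F]_k) :
  \det (a%:M + X *m Y) = \det (a%:M + Y *m X).
Proof.
have [->|a0] := eqVneq a 0.
  by rewrite -scalemx1 scale0r !add0r !det_mulmx mulrC.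
pose B := block_mx (a%:M : 'M_k) (- X) Y (1%:M : 'M_k).
have e1 : \det B = \det (a%:M + X *m Y).
  have : B = block_mx 1%:M (- X) 0 1%:M *m block_mx (a%:M + X *m Y) 0 Y 1%:M.
    rewrite mulmx_block !mul1mx !mul0mx !mulmx1 !add0r mulNmx.
    by rewrite addrK.
  by move->; rewrite det_mulmx det_ublock det_lblock !det1 !mulr1 mul1r.
have e2 : \det B * a ^+ k = a ^+ k * \det (a%:M + Y *m X).
  have : B *m block_mx 1%:M X 0 a%:M = block_mx a%:M 0 Y (a%:M + Y *m X).
    rewrite mulmx_block !mulmx1 !mulmx0 !addr0 mul1mx mulNmx.
    by rewrite -scalar_mxC addrN addrC.
  move/(congr1 determinant).
  by rewrite det_mulmx det_ublock det_lblock det1 mul1r det_scalar.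
have ak : a ^+ k != 0 by rewrite expf_neq0.
by apply: (mulIf ak); rewrite -e1 e2 mulrC.
Qed.

Section Courant.
Variable R : realType.
Local Notation C := R[i].

(** [Y Y^*] is an orthogonal projection, so [1 - Y Y^*] is its own Gram matrix. *)
Lemma isometry_le1 n k (Y : 'M[C]_(n, k)) : Y^t* *m Y = 1%:M ->
  loewner_le (Y *m Y^t*) 1%:M.
Proof.
move=> hY; rewrite /loewner_le; set P := Y *m Y^t*.
have PP : P *m P = P by rewrite /P mulmxA -(mulmxA Y) hY mulmx1.
have aP : P^t* = P by rewrite /P adjmxM trmxCK.
have := psdmx_gram (1%:M - P).
rewrite adjmxD adjmxN adjmx1 aP mulmxBr mulmx1 mulmxBl mul1mx PP.
by rewrite subrr subr0.
Qed.

Lemma rdiag_block k r (d : 'I_(k + r) -> R) :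
  rdiag d = block_mx (rdiag (fun i => d (lshift r i))) 0 0
                     (rdiag (fun i => d (rshift k i))).
Proof.
rewrite /rdiag -diag_mx_row; congr diag_mx.
rewrite -[LHS]hsubmxK; congr row_mx; apply/rowP => i; rewrite !mxE //.
Qed.

(* On the last r coordinates d is at most mu, so the compression is at most
   mu + Y1^* (d1 - mu) Y1, whose determinant is unchanged when Y1^* (d1 - mu) Y1
   is replaced by (d1 - mu)^(1/2) Y1 Y1^* (d1 - mu)^(1/2) <= d1 - mu. *)
Lemma det_isometry_rdiag k r (d : 'I_(k + r) -> R) (mu : R)
    (Y : 'M[C]_(k + r, k)) :
  0 <= mu -> (forall i, mu <= d (lshift r i)) ->
  (forall i, 0 <= d (rshift k i) <= mu) -> Y^t* *m Y = 1%:M ->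
  \det (Y^t* *m rdiag d *m Y) <= (\prod_i d (lshift r i))%:C.
Proof.
move=> mu0 dl dr hY.
pose Y1 := usubmx Y; pose Y2 := dsubmx Y.
have eY : Y = col_mx Y1 Y2 by rewrite vsubmxK.
have eYa : Y^t* = row_mx (Y1^t* ) (Y2^t* ) by rewrite eY tr_col_mx map_row_mx.
pose E : 'M[C]_(k + r, k) := col_mx 1%:M 0.
have aE : E^t* = row_mx 1%:M 0.
  by rewrite tr_col_mx map_row_mx adjmx1 trmx0 map_mx0.
(* [Y1 Y1^*] is the upper left corner of the projection [Y Y^*], cut out by [E]. *)
have Y1le : loewner_le (Y1 *m Y1^t*) 1%:M.
  have := loewner_le_congr E (isometry_le1 hY).
  have EY : E^t* *m Y = Y1 by rewrite aE eY mul_row_col mul1mx mul0mx addr0.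
  rewrite mulmxA EY -mulmxA (_ : Y^t* *m E = Y1^t* ); last first.
    by rewrite -EY adjmxM trmxCK.
  rewrite mulmx1 aE.
  by rewrite mul_row_col mulmx1 mulmx0 addr0.
pose d1 i := d (lshift r i); pose d2 i := d (rshift k i).
pose G : 'M[C]_k := rdiag (fun i => Num.sqrt (d1 i - mu)).
have aG : G^t* = G by apply: rdiag_adj.
have GG : G *m G = rdiag (fun i => d1 i - mu).
  rewrite rdiagM; apply: eq_rdiag => i.
  by rewrite -expr2 sqr_sqrtr ?subr_ge0 ?dl.
clearbody G Y1 Y2.
have le1 : loewner_le (Y^t* *m rdiag d *m Y)
                      (mu%:C%:M + (G *m Y1)^t* *m (G *m Y1)).
  have -> : Y^t* *m rdiag d *m Y =
            Y1^t* *m rdiag d1 *m Y1 + Y2^t* *m rdiag d2 *m Y2.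
    rewrite eYa rdiag_block mul_row_block !mulmx0 addr0 add0r {1}eY.
    by rewrite mul_row_col.
  have -> : mu%:C%:M + (G *m Y1)^t* *m (G *m Y1) =
            Y1^t* *m rdiag d1 *m Y1 + Y2^t* *m rdiag (fun=> mu) *m Y2.
    rewrite adjmxM aG !mulmxA -(mulmxA (Y1^t* ) G) GG.
    have -> : mu%:C%:M = mu%:C *: (Y1^t* *m Y1 + Y2^t* *m Y2) :> 'M[C]_k.
      by rewrite -mul_row_col -eYa -eY hY scalemx1.
    rewrite -rdiagB !rdiag_cst mulmxBr mulmxBl !mul_mx_scalar -!scalemxAl.
    by rewrite scalerDr [LHS]addrC addrA subrK.
  apply: loewner_leD; first by rewrite /loewner_le subrr; apply: psdmx0.
  by apply: loewner_le_congr; apply: rdiag_le => i; case/andP: (dr i).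
have psdY : psdmx (Y^t* *m rdiag d *m Y).
  apply/psdmx_congr/rdiag_ge0 => i; rewrite -(splitK i); case: split => j /=.
    exact: le_trans mu0 (dl j).
  by case/andP: (dr j).
apply: (le_trans (loewner_le_det psdY le1)).
rewrite det_scalarD_mulC adjmxM aG mulmxA -(mulmxA G Y1).
rewrite -det_rdiag; apply: loewner_le_det.
  apply: psdmxD.
    by rewrite -rdiag_cst; apply: rdiag_ge0.
  have := psdmx_gram ((G *m Y1)^t* ).
  by rewrite trmxCK adjmxM aG !mulmxA.
have -> : rdiag d1 = mu%:C%:M + G^t* *m 1%:M *m G.
  by rewrite mulmx1 aG GG -rdiagB rdiag_cst addrC subrK.
rewrite -{1}aG; apply: loewner_leD.
  by rewrite /loewner_le subrr; apply: psdmx0.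
exact: (loewner_le_congr G Y1le).
Qed.

(** If [Y^* Y] is singular, both sides vanish. Otherwise [Y^* Y = G^* G] and [Y = Z G] with [Z] an
    isometry; the determinant of [G^* G] factors out, and diagonalising [T] leaves the case of
    [det_isometry_rdiag]. *)
Lemma det_congr_le n k (T : 'M[C]_n) (Y : 'M[C]_(n, k)) :
  (0 < k)%N -> (k <= n)%N -> psdmx T ->
  \det (Y^t* *m T *m Y) <= (\prod_(j < k) lambda T j)%:C * \det (Y^t* *m Y).
Proof.
move=> k0 kn hT.
have [Y0|Y0] := eqVneq (\det (Y^t* *m Y)) 0.
  rewrite Y0 mulr0; have /det0_colP [v v0 Yv] := introT eqP Y0.
  have {}Yv : Y *m v = 0.
    apply: gram_eq0; rewrite adjmxM mulmxA -(mulmxA (v^t* )) -mulmxA Yv.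
    by rewrite mulmx0 mxE.
  suff -> : \det (Y^t* *m T *m Y) = 0 by [].
  by apply: (det0_col v0); rewrite -mulmxA Yv mulmx0.
have [G eG] := psdmx_sqrt (psdmx_gram Y).
have uG : G \in unitmx.
  rewrite unitmxE unitfE; apply: contraNneq Y0.
  by rewrite eG det_mulmx => ->; rewrite mulr0.
pose Z := Y *m invmx G.
have eZ : Y = Z *m G by rewrite mulmxKV.
have hZ : Z^t* *m Z = 1%:M.
  rewrite /Z adjmxM -mulmxA (mulmxA _ Y) eG !mulmxA -adjmxM.
  by rewrite mulmxV // adjmx1 mul1mx mulmxV.
clearbody Z; suff h : \det (Z^t* *m T *m Z) <= (\prod_(j < k) lambda T j)%:C.
  have -> : Y^t* *m T *m Y = G^t* *m (Z^t* *m T *m Z) *m G.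
    by rewrite eZ adjmxM !mulmxA.
  rewrite eG !det_mulmx mulrAC mulrC ler_wpM2r // -det_mulmx.
  by apply/det_psdmx_ge0/psdmx_gram.
have [U uU [eT l0 ld]] := psdmx_lambda hT.
have -> : Z^t* *m T *m Z =
          (U *m Z)^t* *m rdiag (fun i => lambda T i) *m (U *m Z).
  transitivity (Z^t* *m (U^t* *m rdiag (fun i => lambda T i) *m U) *m Z).
    by rewrite -eT.
  by rewrite adjmxM !mulmxA.
have hUZ : (U *m Z)^t* *m (U *m Z) = 1%:M.
  by rewrite adjmxM -mulmxA (mulmxA _ U) unitarymx_adjK // mul1mx.
(* The threshold [mu] will be the [k]-th largest eigenvalue, whose index is [k.-1]. *)
have ek := prednK k0.
have kn' : (k.-1 < n)%N by rewrite ek.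
have := l0 (Ordinal kn'); move: l0 ld => /=.
move: (lambda T) (U *m Z) hUZ => l.
have [r en] : exists r, n = (k + r)%N by exists (n - k)%N; rewrite subnKC.
subst n => W hW l0 ld mu0.
apply: (le_trans (det_isometry_rdiag mu0 _ _ hW)) => //=.
- move=> i; apply: (ld (lshift r i) (Ordinal kn')) => /=.
  by rewrite -ltnS ek.
- move=> i; apply/andP; split; first exact: (l0 (rshift k i)).
  apply: (ld (Ordinal kn') (rshift k i)) => /=.
  exact: leq_trans (leq_pred k) (leq_addr _ _).
Qed.

End Courant.

(** * Powers of positive semidefinite matrices *)

Section Pow.
Variable R : realType.
Local Notation C := R[i].

(** Makes functional calculus independent of the chosen diagonalisation. The matrix [Q = V U^*]
    intertwines the two diagonals, so an entry [Q i j] is nonzero only where [e_i = d_j], and there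
    [f] takes equal values. *)
Lemma diag_calculus (F : numClosedFieldType) n (U V : 'M[F]_n)
    (d e : 'rV[F]_n) (f : F -> F) :
  U \is unitarymx -> V \is unitarymx ->
  U^t* *m diag_mx d *m U = V^t* *m diag_mx e *m V ->
  U^t* *m diag_mx (map_mx f d) *m U = V^t* *m diag_mx (map_mx f e) *m V.
Proof.
move=> uU uV h; pose Q := V *m U^t*.
have hQ : Q *m diag_mx d = diag_mx e *m Q.
  have /(congr1 (fun M => V *m M *m U^t*)) := h.
  rewrite !mulmxA (unitarymxP uV) mul1mx -(mulmxA _ U) (unitarymxP uU) mulmx1.
  by rewrite -mulmxA.
have {}hQ : Q *m diag_mx (map_mx f d) = diag_mx (map_mx f e) *m Q.
  apply/matrixP => i j; have /matrixP/(_ i j) := hQ.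
  rewrite !mul_mx_diag !mul_diag_mx !mxE mulrC => /eqP.
  rewrite -subr_eq0 -mulrBl mulf_eq0 subr_eq0 => /orP[/eqP ->|/eqP ->].
    by rewrite mulrC.
  by rewrite mulr0 mul0r.
have /(congr1 (fun M => V^t* *m M *m U)) := hQ.
rewrite /Q !mulmxA unitarymx_adjK // mul1mx => ->.
by rewrite -!mulmxA unitarymx_adjK // mulmx1.
Qed.

Lemma psdpow_rdiag n (A U : 'M[C]_n) (d : 'I_n -> R) r : U \is unitarymx ->
  A = U^t* *m rdiag d *m U ->
  psdpow A r = U^t* *m rdiag (fun i => powR (d i) r) *m U.
Proof.
move=> uU eA.
have nA : A \is normalmx.
  apply/normalmxP; have -> // : A^t* = A.
  by rewrite eA !adjmxM trmxCK rdiag_adj mulmxA.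
have := orthomx_spectralP nA; have uV := spectral_unitarymx A.
rewrite /psdpow (invmx_unitary uV) => eA'.
rewrite eA' in eA.
pose f z : C := (powR (complex.Re z) r)%:C.
have := diag_calculus f uV uU eA.
have -> : map_mx f (\row_i (d i)%:C) = \row_i (powR (d i) r)%:C.
  by apply/rowP => i; rewrite !mxE.
exact.
Qed.

(** At [x = 0] the law fails for opposite nonzero exponents, because [powR 0 0 = 1]; nonnegative
    exponents with sum 0 are both 0. *)
Lemma powRD_ge0 (x r s : R) : 0 <= r -> 0 <= s ->
  powR x (r + s) = powR x r * powR x s.
Proof.
move=> r0 s0; have [e|ne] := eqVneq (r + s) 0; last first.
  by rewrite powRD // (negPf ne).
have /andP[/eqP -> /eqP ->] : (r == 0) && (s == 0) by rewrite -paddr_eq0 // e.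
by rewrite addr0 !powRr0 mulr1.
Qed.

Lemma psdpowD n (A : 'M[C]_n) r s : psdmx A -> 0 <= r -> 0 <= s ->
  psdpow A r *m psdpow A s = psdpow A (r + s).
Proof.
case/psdmx_spectral => U uU [d d0 eA] r0 s0; rewrite !(psdpow_rdiag _ uU eA).
rewrite -!mulmxA (mulmxA U) (unitarymxP uU) mul1mx; congr (_ *m _).
rewrite mulmxA rdiagM; congr (_ *m _); apply: eq_rdiag => i.
by rewrite powRD_ge0.
Qed.

Lemma psdpow0 n (A : 'M[C]_n) : psdmx A -> psdpow A 0 = 1%:M.
Proof.
case/psdmx_spectral => U uU [d d0 eA]; rewrite (psdpow_rdiag _ uU eA).
rewrite (eq_rdiag (fun i => powRr0 (d i))) rdiag_cst mulmx1.
exact: unitarymx_adjK.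
Qed.

Lemma psdpow1 n (A : 'M[C]_n) : psdmx A -> psdpow A 1 = A.
Proof.
case/psdmx_spectral => U uU [d d0 eA]; rewrite (psdpow_rdiag _ uU eA).
by rewrite (eq_rdiag (fun i => powRr1 (d0 i))) -eA.
Qed.

Lemma psdpow_psd n (A : 'M[C]_n) r : psdmx A -> psdmx (psdpow A r).
Proof.
case/psdmx_spectral => U uU [d d0 eA]; rewrite (psdpow_rdiag _ uU eA).
by apply: psdmx_congr; apply: rdiag_ge0 => i; exact: powR_ge0.
Qed.

Lemma lambda_psdpow n (A : 'M[C]_n) r (j : 'I_n) : psdmx A -> 0 <= r ->
  lambda (psdpow A r) j = powR (lambda A j) r.
Proof.
case/psdmx_lambda => U uU [eA l0 ld] r0.
rewrite (psdpow_rdiag _ uU eA) lambda_rdiag // => i i' ii'.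
by apply: ge0_ler_powR; rewrite ?nnegrE //; apply: ld.
Qed.

Lemma absmx_psd n (M : 'M[C]_n) : psdmx (absmx M).
Proof. exact/psdpow_psd/psdmx_gram. Qed.

Lemma absmx_sqr n (M : 'M[C]_n) : absmx M *m absmx M = M^t* *m M.
Proof.
rewrite /absmx psdpowD ?invr_ge0 //; last exact: psdmx_gram.
have -> : 2^-1 + 2^-1 = 1 :> R by lra.
by rewrite psdpow1 //; apply: psdmx_gram.
Qed.

Lemma absmx_normal n (U : 'M[C]_n) (d : 'rV[C]_n) : U \is unitarymx ->
  absmx (U^t* *m diag_mx d *m U) =
  U^t* *m rdiag (fun i => complex.Re `|d 0 i|) *m U.
Proof.
move=> uU; rewrite /absmx.
have xE i : (complex.Re `|d 0 i|)%:C = `|d 0 i|.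
  by apply: RRe_real; apply: normr_real.
have x0 i : 0 <= complex.Re `|d 0 i|.
  by rewrite -lecR xE; exact: (normr_ge0 (d 0 i)).
have -> : (U^t* *m diag_mx d *m U)^t* *m (U^t* *m diag_mx d *m U) =
    U^t* *m rdiag (fun i => complex.Re `|d 0 i| ^+ 2) *m U.
  rewrite !adjmxM trmxCK -!mulmxA (mulmxA U (U^t* )) (unitarymxP uU) mul1mx.
  congr (_ *m _); rewrite !mulmxA; congr (_ *m _).
  rewrite adjmx_diag mulmx_diag; congr diag_mx; apply/rowP => i.
  by rewrite !mxE rmorphXn /= xE normCK mulrC.
have pE i : powR (complex.Re `|d 0 i| ^+ 2) 2^-1 = complex.Re `|d 0 i|.
  by rewrite -powR_mulrn // -powRrM mulfV ?powRr1 // pnatr_eq0.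
by rewrite (psdpow_rdiag _ uU erefl) (eq_rdiag pE).
Qed.

(** One rank-one projection per row of [U], repeated eigenvalues included; a linear map then acts
    term by term. *)
Lemma unitarymx_diag_sum (F : numClosedFieldType) n (U : 'M[F]_n)
    (d : 'rV[F]_n) :
  U^t* *m diag_mx d *m U = \sum_i d 0 i *: ((row i U)^t* *m row i U).
Proof.
apply/matrixP => i j; rewrite summxE mul_mx_diag mxE.
apply: eq_bigr => l _; rewrite !mxE big_ord1 !mxE.
by rewrite mulrAC mulrC.
Qed.

End Pow.

(** * Products of the largest eigenvalues *)

Section Majorization.
Variable R : realType.
Local Notation C := R[i].

Definition ltop n k (T : 'M[C]_n) : R := \prod_(j < k) lambda T j.

Lemma ltop_ge0 n k (T : 'M[C]_n) : (k <= n)%N -> psdmx T -> 0 <= ltop k T.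
Proof.
move=> kn /psdmx_lambda[U uU [_ l0 _]]; apply: prodr_ge0 => i _.
exact: (l0 (widen_ord kn i)).
Qed.

Lemma top_eigenvectors n k (T : 'M[C]_n) : (k <= n)%N -> psdmx T ->
  exists2 V : 'M[C]_(n, k), V^t* *m V = 1%:M &
    T *m V = V *m rdiag (fun j : 'I_k => lambda T j).
Proof.
move=> kn hT; have [U uU [eT _ _]] := psdmx_lambda hT.
pose f := widen_ord kn.
have eTU : T *m U^t* = U^t* *m rdiag (fun i => lambda T i).
  by rewrite [in LHS]eT mulmxtVK.
exists (colsub f (U^t* )).
  apply/matrixP => i j; have /unitarymxP/matrixP/(_ (f i) (f j)) := uU.
  rewrite !mxE => h; transitivity ((f i == f j)%:R : C); last by [].
  rewrite -h; apply: eq_bigr => l _; rewrite !mxE.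
  by rewrite conjCK.
apply/matrixP => i j; have /matrixP/(_ i (f j)) := eTU.
rewrite !mul_mx_diag !mxE => <-; apply: eq_bigr => l _; rewrite !mxE //.
Qed.

Lemma lambda_le n (T : 'M[C]_n) (c : R) (j : 'I_n) :
  psdmx T -> loewner_le T (c%:C%:M) -> lambda T j <= c.
Proof.
move=> hT hc; have [U uU [eT _ _]] := psdmx_lambda hT.
have := psdmx_ge0 (U^t* *m delta_mx j 0) hc.
have -> : c%:C%:M - T = U^t* *m rdiag (fun i => c - lambda T i) *m U.
  rewrite -rdiagB rdiag_cst mulmxBr mulmxBl -eT; congr (_ - _).
  by rewrite scalar_mxC -mulmxA unitarymx_adjK // mulmx1.
by rewrite unitarymx_form // rdiag_delta lecR subr_ge0.
Qed.

Lemma ltop_le n k (T : 'M[C]_n) (c : R) : (k <= n)%N ->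
  psdmx T -> loewner_le T (c%:C%:M) -> ltop k T <= c ^+ k.
Proof.
move=> kn hT hc; rewrite -[k in _ ^+ k]card_ord -prodr_const.
apply: ler_prod => i _.
rewrite (lambda_le (widen_ord kn i) hT hc) andbT.
have [U uU [_ l0 _]] := psdmx_lambda hT.
exact: (l0 (widen_ord kn i)).
Qed.

(** For [V] the top eigenvectors of [|M|] and [L] their eigenvalues, [W = M V L^-1] is an isometry,
    as in the polar decomposition, and [W^* M V = L]. The block inequality then bounds [det L ^ 2]
    by two compressions of [X], each at most [ltop k X]. *)
Lemma ltop_absmx_le n k (X M : 'M[C]_n) : (0 < k)%N -> (k <= n)%N ->
  psdmx X -> psdmx2 X M X -> ltop k (absmx M) <= ltop k X.
Proof.
move=> k0 kn hX hM; have hH := absmx_psd M.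
have eH := absmx_sqr M; move: (absmx M) hH eH => H hH eH.
have [V VV HV] := top_eigenvectors kn hH.
set L := rdiag _ in HV.
have dL : \det L = (ltop k H)%:C by apply: det_rdiag.
have [->|L0] := eqVneq (ltop k H) 0; first exact: ltop_ge0.
have uL : L \in unitmx.
  by rewrite unitmxE unitfE dL fmorph_eq0.
have aL : L^t* = L by apply: rdiag_adj.
clearbody L.
have MMV : M^t* *m M *m V = V *m L *m L.
  by rewrite -eH -(mulmxA H H V) HV (mulmxA H V L) HV.
pose W := M *m V *m invmx L.
have WMV : W^t* *m M *m V = L.
  have -> : W^t* = (invmx L)^t* *m V^t* *m M^t* by rewrite /W !adjmxM mulmxA.
  have -> : (invmx L)^t* = invmx L.
    have h : (invmx L)^t* *m L = 1%:M.
      by rewrite -{2}aL -adjmxM mulmxV // adjmx1.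
    by rewrite -[LHS]mulmx1 -(mulmxV uL) mulmxA h mul1mx.
  rewrite -!mulmxA (mulmxA (M^t* )) MMV -!mulmxA (mulmxA (V^t* )) VV mul1mx.
  by rewrite mulKmx.
have WW : W^t* *m W = 1%:M by rewrite {2}/W !mulmxA WMV mulmxV.
clearbody W.
have h := psdmx2_det (psdmx_congr W hX) (psdmx_congr V hX)
                     (psdmx2_congr W V hM).
have dW : \det (W^t* *m X *m W) <= (ltop k X)%:C.
  by have := det_congr_le W k0 kn hX; rewrite WW det1 mulr1.
have dV : \det (V^t* *m X *m V) <= (ltop k X)%:C.
  by have := det_congr_le V k0 kn hX; rewrite VV det1 mulr1.
have dX0 := ltop_ge0 kn hX; have dH0 := ltop_ge0 kn hH.
have det0 l (Y : 'M[C]_(n, l)) : 0 <= \det (Y^t* *m X *m Y).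
  by apply/det_psdmx_ge0/psdmx_congr.
have {}h := le_trans h (ler_pM (det0 _ W) (det0 _ V) dW dV).
move: h dX0 dH0; rewrite WMV dL; move: (ltop k H) (ltop k X) => a b h b0 a0.
move: h; rewrite ger0_norm ?lecR // -rmorphXn -rmorphM lecR -expr2.
by rewrite ler_pXn2r ?nnegrE.
Qed.

(* Applied with P, Q, W, E the powers A^s, A^h, A^t, A^(h-s).  With V the top
   eigenvectors of QHQ, the vectors Y play the role of E^-1 V without requiring
   E to be invertible. *)
Lemma ltop_midpoint n k (S H T P Q W E : 'M[C]_n) : (0 < k)%N -> (k <= n)%N ->
  psdmx S -> psdmx H -> psdmx T -> psdmx2 S H T ->
  P^t* = P -> Q^t* = Q -> W^t* = W ->
  E *m P = Q -> Q *m E = W ->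
  ltop k (Q *m H *m Q) ^+ 2 <= ltop k (P *m S *m P) * ltop k (W *m T *m W).
Proof.
move=> k0 kn hS hH hT hSHT aP aQ aW EP QE.
have pQ : psdmx (Q *m H *m Q) by have := psdmx_congr Q hH; rewrite aQ.
have pP : psdmx (P *m S *m P) by have := psdmx_congr P hS; rewrite aP.
have pW : psdmx (W *m T *m W) by have := psdmx_congr W hT; rewrite aW.
have [V VV HV] := top_eigenvectors kn pQ.
set L := rdiag _ in HV.
have dL : \det L = (ltop k (Q *m H *m Q))%:C by apply: det_rdiag.
have [->|L0] := eqVneq (ltop k (Q *m H *m Q)) 0.
  by rewrite expr0n mulr_ge0 // ltop_ge0.
have uL : L \in unitmx by rewrite unitmxE unitfE dL fmorph_eq0.
clearbody L.
(* Chosen so that [Q Z = V]; since [E P = Q], the matrix [Y = P Z] then solves [E Y = V]. *)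
pose Z := H *m Q *m V *m invmx L.
have QZ : Q *m Z = V by rewrite /Z !mulmxA HV mulmxK.
have ZL : Z *m L = H *m Q *m V by rewrite /Z mulmxKV.
clearbody Z.
pose Y := P *m Z.
have EY : E *m Y = V by rewrite /Y mulmxA EP.
have WY : W *m Y = Q *m V by rewrite -QE -mulmxA EY.
have PHWY : P *m H *m (W *m Y) = Y *m L by rewrite WY /Y -!mulmxA ZL !mulmxA.
clearbody Y.
have Y0 : \det (Y^t* *m Y) != 0.
  apply/negP => /det0_colP[v v0 Yv].
  have {}Yv : Y *m v = 0.
    apply: gram_eq0; rewrite adjmxM mulmxA -(mulmxA (v^t* )) -mulmxA Yv.
    by rewrite mulmx0 mxE.
  have Vv : V *m v = 0 by rewrite -EY -mulmxA Yv mulmx0.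
  by move: v0; rewrite -[v]mul1mx -VV -mulmxA Vv mulmx0 eqxx.
have Yp : 0 < \det (Y^t* *m Y).
  by rewrite lt_def Y0; apply/det_psdmx_ge0/psdmx_gram.
have h2 := psdmx2_congr Y Y (psdmx2_congr P W hSHT).
rewrite aP aW in h2.
(* The columns of [Y] span an invariant subspace of [P H W], on which it acts by [L]. *)
have eL : \det (Y^t* *m (P *m H *m W) *m Y) =
          \det (Y^t* *m Y) * (ltop k (Q *m H *m Q))%:C.
  by rewrite -dL -det_mulmx -!mulmxA -PHWY !mulmxA.
have h := psdmx2_det (psdmx_congr Y pP) (psdmx_congr Y pW) h2.
have {}h := eq_ind _ (fun z => `|z| ^+ 2 <= _) h _ eL.
have dP : \det (Y^t* *m (P *m S *m P) *m Y) <=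
          (ltop k (P *m S *m P))%:C * \det (Y^t* *m Y) :=
            det_congr_le Y k0 kn pP.
have dW : \det (Y^t* *m (W *m T *m W) *m Y) <=
          (ltop k (W *m T *m W))%:C * \det (Y^t* *m Y) :=
            det_congr_le Y k0 kn pW.
have {}h := le_trans h (ler_pM (det_psdmx_ge0 (psdmx_congr Y pP))
  (det_psdmx_ge0 (psdmx_congr Y pW)) dP dW).
move: h (ltop_ge0 kn pQ) Yp; clear.
move: (\det (Y^t* *m Y)) (ltop k (Q *m H *m Q)).
move: (ltop k (P *m S *m P)) (ltop k (W *m T *m W)).
move=> a b y q h q0 y0.
have y2 : 0 < y ^+ 2 by rewrite exprn_gt0.
(* Both sides carry the square of [det (Y^* Y)], which is positive and cancels. *)
rewrite -lecR -(ler_pM2l y2) rmorphXn rmorphM /= -exprMn.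
have -> : y ^+ 2 * (a%:C * b%:C) = a%:C * y * (b%:C * y) by ring.
by move: h; rewrite ger0_norm // mulr_ge0 ?lecR // ltW.
Qed.

End Majorization.

(** * Bounded midpoint log-convex functions *)

Section Interpolation.
Variable R : realType.

(** Iterating the second hypothesis gives [G t ^+ (2 ^ n) <= c] for every [n]. If [G t > 1],
    Bernoulli's inequality makes these powers unbounded. *)
Lemma dyadic_le1 (G : R -> R) (p c : R) : 0 < p ->
  (forall t : R, 0 <= t <= p -> 0 <= G t <= c) ->
  (forall t : R, 0 <= t <= p -> exists2 u, 0 <= u <= p & G t ^+ 2 <= G u) ->
  forall t, 0 <= t <= p -> G t <= 1.
Proof.
move=> p0 hb hs t ht; rewrite leNgt; apply/negP => gt1.
have hpow n : forall t, 0 <= t <= p -> G t ^+ (2 ^ n) <= c.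
  elim: n => [|n IH] u hu; first by rewrite expr1; case/andP: (hb _ hu).
  have [v hv le] := hs _ hu; rewrite expnS exprM.
  apply: le_trans (IH v hv); apply: lerXn2r; rewrite ?nnegrE ?exprn_ge0 //.
  - by case/andP: (hb _ hu).
  - by case/andP: (hb _ hv).
have bern n : 1 + n%:R * (G t - 1) <= G t ^+ n.
  elim: n => [|n IH]; first by rewrite mul0r addr0 expr0.
  rewrite exprS.
  apply: (@le_trans _ _ (G t * (1 + n%:R * (G t - 1)))); last first.
    by rewrite ler_wpM2l // (le_trans ler01) // ltW.
  have : 0 <= n%:R * (G t - 1) ^+ 2 by rewrite mulr_ge0 // sqr_ge0.
  rewrite -natr1; move: (n%:R) (G t) => a g; nra.
have g0 : 0 < G t - 1 by rewrite subr_gt0.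
have c0 : 0 <= c by case/andP: (hb _ ht) => h1 h2; apply: le_trans h2.
pose n := Num.bound (c / (G t - 1)).
have : c / (G t - 1) < n%:R by apply: archi_boundP; rewrite divr_ge0 // ltW.
rewrite ltr_pdivrMr // => hc.
have hn : (n%:R : R) <= (2 ^ n)%:R by rewrite ler_nat ltnW // ltn_expl.
have := le_trans (bern (2 ^ n)%N) (hpow n _ ht).
have : n%:R * (G t - 1) <= (2 ^ n)%:R * (G t - 1) by rewrite ler_wpM2r // ltW.
by lra.
Qed.

(** Compares [F] with the geometric function [w t = q ^ (t / p)], which is 1 at 0 and [q] at [p]:
    [dyadic_le1] applied to [F / w] gives [F 1 <= q ^ (1 / p)]. *)
Lemma midpoint_powR_le (F : R -> R) (p c : R) : 1 <= p ->
  (forall t : R, 0 <= t <= p -> 0 <= F t <= c) -> F 0 <= 1 ->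
  (forall s h t : R, 0 <= s -> s <= h -> h <= t -> t <= p -> s + t = 2 * h ->
    F h ^+ 2 <= F s * F t) ->
  powR (F 1) p <= F p.
Proof.
move=> p1 hb F0 hm; have p0 : 0 < p by lra.
have Fp0 : 0 <= F p by have := hb p; rewrite lexx ltW // => /(_ isT)/andP[].
have F10 : 0 <= F 1 by have := hb 1; rewrite ler01 p1 => /(_ isT)/andP[].
(* Taking [q] strictly above [F p] keeps [w] positive even when [F p = 0]. *)
suff h q : F p < q -> powR (F 1) p <= q.
  by apply/ler_addgt0Pr => e e0; apply: h; rewrite ltrDl.
move=> hq; have q0 : 0 < q by apply: le_lt_trans hq.
pose w t := powR q (t / p).
have w0 t : 0 < w t by apply: powR_gt0.
have wD s t : w (s + t) = w s * w t.
  by rewrite /w mulrDl powRD // [q == 0]gt_eqF // implybT.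
have wp : w p = q by rewrite /w divff ?gt_eqF // powRr1 // ltW.
have key : forall t, 0 <= t <= p -> F t / w t <= 1.
  (* On [[0, p]] the values of [w] lie between 1 and [q], so [F / w] is bounded by [c / m]. *)
  pose m := Num.min 1 q.
  have m0 : 0 < m by rewrite lt_min ltr01 q0.
  have wm t : 0 <= t <= p -> m <= w t.
    case/andP => t0 tp; rewrite /w.
    have t1 : t / p <= 1 by rewrite ler_pdivrMr // mul1r.
    have t2 : 0 <= t / p by rewrite divr_ge0 // ltW.
    have [q1|q1] := leP 1 q.
      rewrite ge_min; apply/orP; left.
      by rewrite -(powRr0 q); apply: ler_powR.
    rewrite ge_min; apply/orP; right.
    have -> : t / p = 1 - (1 - t / p) by ring.
    rewrite powRB; last by rewrite [q == 0]gt_eqF // implybT.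
    rewrite powRr1 ?(ltW q0) // ler_pdivlMr ?powR_gt0 //.
    rewrite ler_piMr ?(ltW q0) //.
    apply: (@le_trans _ _ (powR 1 (1 - t / p))); last by rewrite powR1.
    by rewrite ge0_ler_powR ?nnegrE ?subr_ge0 ?(ltW q0) ?(ltW q1).
  apply: (@dyadic_le1 _ p (c / m)) => // t ht; case/andP: (ht) => t0 tp.
    have /andP[f0 fc] := hb t ht.
    rewrite divr_ge0 ?(ltW (w0 t)) //=.
    apply: (@le_trans _ _ (F t / m)).
      by rewrite ler_wpM2l // lef_pV2 ?posrE // wm.
    by rewrite ler_wpM2r // invr_ge0 ltW.
  (* [t] is the midpoint of 0 and [2 t], or of [2 t - p] and [p], whichever pair stays in [[0, p]].
     The factor at the fixed endpoint is absorbed by [F 0 <= 1] or by [F p <= q]. *)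
  have [h2|h2] := leP (2 * t) p.
    have hu : 0 <= 2 * t <= p by rewrite h2 mulr_ge0.
    exists (2 * t) => //.
    have e2 : w (2 * t) = w t ^+ 2 by rewrite expr2 -wD; congr w; ring.
    rewrite e2 expr_div_n ler_wpM2r ?invr_ge0 ?exprn_ge0 ?(ltW (w0 _)) //.
    have := hm 0 t (2 * t); rewrite lexx add0r => /(_ isT t0 _ h2 erefl) h3.
    apply: le_trans (h3 _) _; first by lra.
    by rewrite ler_piMl //; case/andP: (hb _ hu).
  have hu : 0 <= 2 * t - p <= p by apply/andP; split; lra.
  exists (2 * t - p) => //.
  have e2 : w t ^+ 2 = w (2 * t - p) * q.
    by rewrite expr2 -wD -wp -wD; congr w; ring.
  rewrite expr_div_n e2 invfM mulrA.
  rewrite mulrAC ler_wpM2r ?invr_ge0 ?(ltW (w0 _)) //.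
  rewrite ler_pdivrMr //.
  have h3 : F t ^+ 2 <= F (2 * t - p) * F p.
    by apply: hm; try lra; case/andP: hu.
  apply: le_trans h3 _; rewrite ler_wpM2l ?(ltW hq) //.
  by case/andP: (hb _ hu).
have := key 1; rewrite ler01 p1 => /(_ isT); rewrite ler_pdivrMr // mul1r => h.
have := @ge0_ler_powR _ p (ltW p0) (F 1) (w 1);
  rewrite !nnegrE => /(_ F10 (ltW (w0 _)) h).
by rewrite /w -powRrM div1r mulVf ?gt_eqF // powRr1 // ltW.
Qed.

End Interpolation.

(** * The interpolating family *)

Lemma prod_powR (R : realType) k (f : 'I_k -> R) p : (forall j, 0 <= f j) ->
  \prod_j powR (f j) p = powR (\prod_j f j) p.
Proof.
move=> f0.
suff [] : \prod_j powR (f j) p = powR (\prod_j f j) p /\ 0 <= \prod_j f j by [].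
elim/big_rec2: _ => [|j y z _ [-> z0]]; first by rewrite powR1.
by rewrite powRM // mulr_ge0.
Qed.

Section Family.
Variables (R : realType) (n : nat) (I : finType).
Local Notation C := R[i].
Variables (A : 'M[C]_n) (K : I -> 'M[C]_n) (x : I -> R).
Hypotheses (psdA : psdmx A) (psdK : forall i, psdmx (K i)).
Hypotheses (subK : loewner_le (\sum_i K i) 1%:M) (x0 : forall i, 0 <= x i).

(** For [K i = Phi(P_i)] and [x i = |d_i|] this is [Phi(|N|^t)]. *)
Definition wpow (t : R) : 'M[C]_n := \sum_i (powR (x i) t)%:C *: K i.

Definition sandwich t : 'M[C]_n := psdpow A t *m wpow t *m psdpow A t.

Lemma wpow_psd t : psdmx (wpow t).
Proof.
apply: psdmx_sum => i.
have w0 : 0 <= (powR (x i) t)%:C by rewrite lecR powR_ge0.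
exact: (psdmxZ w0 (psdK i)).
Qed.

Lemma psdpow_adj t : (psdpow A t)^t* = psdpow A t.
Proof. exact/psdmx_adj/psdpow_psd. Qed.

Lemma sandwich_psd t : psdmx (sandwich t).
Proof.
by have := psdmx_congr (psdpow A t) (wpow_psd t); rewrite psdpow_adj.
Qed.

(** The weights may be complex: real ones serve for [wpow], and complex ones carry the phases of the
    eigenvalues of [N]. *)
Lemma psdmx2_wsum (a b : I -> C) :
  psdmx2 (\sum_i (`|a i| ^+ 2) *: K i) (\sum_i (Num.conj (a i) * b i) *: K i)
         (\sum_i (`|b i| ^+ 2) *: K i).
Proof.
apply: psdmx2_sum => i.
exact: (psdmx2_scale _ _ (psdmx_adj (psdK i)) (fun y => psdmx_ge0 y (psdK i))).
Qed.

Lemma psdmx2_wpow s h t : 0 <= s -> 0 <= t -> s + t = 2 * h ->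
  psdmx2 (wpow s) (wpow h) (wpow t).
Proof.
move=> s0 t0 st.
(* Halved exponents: the squares are [x^s] and [x^t], and the mixed product is [x^h]. *)
have := psdmx2_wsum (fun i => (powR (x i) (s / 2))%:C)
                    (fun i => (powR (x i) (t / 2))%:C).
have sq (y r : R) : 0 <= r -> `|(powR y (r / 2))%:C| ^+ 2 = (powR y r)%:C.
  move=> r0; rewrite ger0_norm ?lecR ?powR_ge0 // -rmorphXn /= expr2.
  rewrite -powRD_ge0 ?divr_ge0 //; congr (powR _ _)%:C; lra.
have e1 r : 0 <= r -> \sum_i (`|(powR (x i) (r / 2))%:C| ^+ 2) *: K i = wpow r.
  by move=> r0; apply: eq_bigr => i _; rewrite sq.
have -> : \sum_i (Num.conj (powR (x i) (s / 2))%:C * (powR (x i) (t / 2))%:C)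
  *: K i = wpow h.
  apply: eq_bigr => i _; congr (_ *: _).
  rewrite geC0_conj ?lecR ?powR_ge0 // -rmorphM /= -powRD_ge0 ?divr_ge0 //.
  by congr (powR _ _)%:C; lra.
by rewrite !e1.
Qed.

Lemma sandwich_midpoint k s h t : (0 < k)%N -> (k <= n)%N ->
  0 <= s -> s <= h -> h <= t -> s + t = 2 * h ->
  ltop k (sandwich h) ^+ 2 <= ltop k (sandwich s) * ltop k (sandwich t).
Proof.
move=> k0 kn s0 sh ht st.
have h0 : 0 <= h := le_trans s0 sh.
have t0 : 0 <= t := le_trans h0 ht.
have hs : 0 <= h - s by rewrite subr_ge0.
have e0 : h + (h - s) = t.
  by rewrite addrA -mulr2n -mulr_natl -st addrAC subrr add0r.
have e1 : psdpow A (h - s) *m psdpow A s = psdpow A h.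
  by rewrite (psdpowD psdA hs s0) subrK.
have e2 : psdpow A h *m psdpow A (h - s) = psdpow A t.
  by rewrite -e0; exact: (psdpowD psdA h0 hs).
exact: (ltop_midpoint k0 kn (wpow_psd s) (wpow_psd h) (wpow_psd t)
  (psdmx2_wpow s0 t0 st) (psdpow_adj s) (psdpow_adj h) (psdpow_adj t) e1 e2).
Qed.

(** Singular [A] and vanishing [x i] are covered, because [powR 0 0 = 1]; sub-unitality thus applies
    to the endpoint 0. *)
Lemma sandwich0 : sandwich 0 = \sum_i K i.
Proof.
rewrite /sandwich psdpow0 // mul1mx mulmx1; apply: eq_bigr => i _.
by rewrite powRr0 scale1r.
Qed.

Lemma wpow_le (b t : R) : (forall i, powR (x i) t <= b) -> 0 <= b ->
  loewner_le (wpow t) (b%:C%:M).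
Proof.
move=> hb b0; have : loewner_le (b%:C *: \sum_i K i) (b%:C *: 1%:M).
  by apply: loewner_leZ => //; rewrite lecR.
rewrite scalemx1; apply: loewner_le_trans.
rewrite /loewner_le scaler_sumr -sumrB; apply: psdmx_sum => i.
have db : 0 <= (b - powR (x i) t)%:C by rewrite lecR subr_ge0.
by have := psdmxZ db (psdK i); rewrite rmorphB scalerBl.
Qed.

Lemma sandwich_bounded (p : R) : 0 <= p ->
  exists2 c : R, 0 <= c & forall t, 0 <= t <= p ->
    loewner_le (sandwich t) c%:C%:M.
Proof.
move=> p0; have [U uU [a a0 eA]] := psdmx_spectral psdA.
(* Dominates every [x i] and every eigenvalue of [A]; the summand 1 gives [b >= 1], so that
   [b^t <= b^p] for [t <= p]. *)
pose b := 1 + \sum_i x i + \sum_i a i.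
have sx : 0 <= \sum_i x i by apply: sumr_ge0.
have sa : 0 <= \sum_i a i by apply: sumr_ge0.
have b1 : 1 <= b by rewrite /b; lra.
have xb i : x i <= b.
  have : x i <= \sum_i x i by rewrite (bigD1 i) //= lerDl sumr_ge0.
  by rewrite /b; lra.
have ab i : a i <= b.
  have : a i <= \sum_i a i by rewrite (bigD1 i) //= lerDl sumr_ge0.
  by rewrite /b; lra.
have b0 : 0 <= b by apply: le_trans b1.
have pb (y t : R) : 0 <= y -> y <= b -> 0 <= t <= p -> powR y t <= powR b p.
  move=> y0 yb /andP[t0 tp]; apply: (@le_trans _ _ (powR b t)).
    by apply: ge0_ler_powR; rewrite ?nnegrE.
  exact: ler_powR.
pose c := powR b p; have c0 : 0 <= c by apply: powR_ge0.
(* One factor [c] bounds the weights [x^t], and the other two bound [A^t A^t]. *)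
exists (c * (c * c)) => [|t ht]; first by rewrite !mulr_ge0.
have le1 : loewner_le (sandwich t) (c%:C *: (psdpow A t *m psdpow A t)).
  have wc := wpow_le (fun i => pb _ _ (x0 i) (xb i) ht) c0.
  have := loewner_le_congr (psdpow A t) wc.
  by rewrite psdpow_adj mul_mx_scalar -scalemxAl.
have e1 : psdpow A t *m psdpow A t =
          U^t* *m rdiag (fun i => powR (a i) t * powR (a i) t) *m U.
  rewrite (psdpow_rdiag _ uU eA) -!mulmxA (mulmxA U) (unitarymxP uU) mul1mx.
  by rewrite (mulmxA (rdiag _)) rdiagM.
have le2 : loewner_le (psdpow A t *m psdpow A t) ((c * c)%:C%:M).
  have -> : (c * c)%:C%:M = U^t* *m rdiag (fun=> c * c) *m U :> 'M[C]_n.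
    by rewrite rdiag_cst mul_mx_scalar -scalemxAl unitarymx_adjK // scalemx1.
  rewrite e1; apply: loewner_le_congr; apply: rdiag_le => i.
  by apply: ler_pM; rewrite ?powR_ge0 ?pb.
have c0' : 0 <= c%:C by rewrite lecR.
have := loewner_le_trans le1 (loewner_leZ c0' le2).
by rewrite scale_scalar_mx -rmorphM.
Qed.

Lemma ltop_sandwich_powR k p : (0 < k)%N -> (k <= n)%N -> 1 <= p ->
  powR (ltop k (sandwich 1)) p <= ltop k (sandwich p).
Proof.
move=> k0 kn p1; have p0 : 0 <= p by apply: le_trans p1.
have [c c0 hc] := sandwich_bounded p0.
have hb t : 0 <= t <= p -> 0 <= ltop k (sandwich t) <= c ^+ k.
  move=> ht; have psdS := sandwich_psd t.
  by rewrite (ltop_ge0 kn psdS) (ltop_le kn psdS (hc t ht)).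
have F0 : ltop k (sandwich 0) <= 1.
  rewrite -[leRHS](expr1n _ k); apply: (ltop_le kn (sandwich_psd 0)).
  by rewrite sandwich0.
exact: (midpoint_powR_le p1 hb F0
  (fun s h t s0 sh ht _ st => sandwich_midpoint k0 kn s0 sh ht st)).
Qed.

End Family.

(** * Specialisation to the spectral decomposition of [N] *)

Theorem theorem2p9 (R : realType) (m n : nat)
    (A : 'M[R[i]]_n) (N : 'M[R[i]]_m)
    (psdA : psdmx A) (normalN : N \is normalmx)
    (Phi : {linear 'M[R[i]]_m -> 'M[R[i]]_n})
    (Phi_pos : positive_map Phi) (Phi_sub : subunital Phi)
    (p : R) (p_ge1 : 1 <= p) :
  wlogmaj (psdpow (absmx (A *m Phi N *m A)) p)
          (psdpow A p *m Phi (psdpow (absmx N) p) *m psdpow A p).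
Proof.
move=> k /andP[k0 kn].
have p0 : 0 <= p by apply: le_trans p_ge1.
have := orthomx_spectralP normalN; have uU := spectral_unitarymx N.
move: (spectralmx N) (spectral_diag N) uU => U d uU.
rewrite (invmx_unitary uU) => eN.
pose x i := complex.Re `|d 0 i|.
have xE i : (x i)%:C = `|d 0 i| by apply: RRe_real; apply: normr_real.
have x0 i : 0 <= x i by rewrite -lecR xE; exact: (normr_ge0 (d 0 i)).
pose K i := Phi ((row i U)^t* *m row i U).
have psdK i : psdmx (K i) by apply/Phi_pos/psdmx_gram.
have PhiE (e : 'rV[R[i]]_m) : Phi (U^t* *m diag_mx e *m U) =
  \sum_i e 0 i *: K i.
  rewrite unitarymx_diag_sum linear_sum; apply: eq_bigr => i _.
  by rewrite linearZ.
have subK : loewner_le (\sum_i K i) 1%:M.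
  have -> // : \sum_i K i = Phi 1%:M.
  have -> : 1%:M = U^t* *m diag_mx (const_mx 1) *m U.
    by rewrite diag_const_mx mulmx1 unitarymx_adjK.
  by rewrite PhiE; apply: eq_bigr => i _; rewrite mxE scale1r.
have absN : absmx N = U^t* *m rdiag x *m U by rewrite {1}eN absmx_normal.
have PhiP t : Phi (psdpow (absmx N) t) = wpow K x t.
  rewrite (psdpow_rdiag _ uU absN) PhiE.
  by apply: eq_bigr => i _; rewrite mxE.
have PhiN : Phi N = \sum_i d 0 i *: K i by rewrite [in LHS]eN PhiE.
have w1 : wpow K x 1 = \sum_i (x i)%:C *: K i.
  by apply: eq_bigr => i _; rewrite powRr1.
(* The weight with diagonal [|d_i|] and corner [d_i] has rank one: it comes from [a = sqrt |d_i|]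
   and [b = d_i / a]. *)
have hN : psdmx2 (wpow K x 1) (Phi N) (wpow K x 1).
  pose s i := (Num.sqrt (x i))%:C.
  have s2 i : s i * s i = (x i)%:C by rewrite -rmorphM -expr2 sqr_sqrtr.
  have ns i : `|s i| = s i by rewrite ger0_norm // lecR sqrtr_ge0.
  (* d_i / s_i is 0 / 0 = 0 when d_i = 0 *)
  have := psdmx2_wsum psdK s (fun i => d 0 i / s i).
  have -> : \sum_i `|s i| ^+ 2 *: K i = wpow K x 1.
    by rewrite w1; apply: eq_bigr => i _; rewrite ns expr2 s2.
  have -> : \sum_i `|d 0 i / s i| ^+ 2 *: K i = wpow K x 1.
    rewrite w1; apply: eq_bigr => i _; congr (_ *: _).
    rewrite normf_div ns -xE expr_div_n [s i ^+ 2]expr2 s2.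
    have [->|xn0] := eqVneq (x i) 0; first by rewrite rmorph0 expr0n mul0r.
    by rewrite expr2 mulfK // fmorph_eq0.
  have -> : \sum_i (Num.conj (s i) * (d 0 i / s i)) *: K i = Phi N.
    rewrite PhiN; apply: eq_bigr => i _; congr (_ *: _).
    rewrite geC0_conj; last by rewrite lecR sqrtr_ge0.
    have [si0|sn0] := eqVneq (s i) 0; last by rewrite mulrC divfK.
    rewrite si0 mul0r; apply/esym/eqP.
    by rewrite -normr_eq0 -xE -s2 si0 mul0r.
  exact.
rewrite PhiP; set M := A *m Phi N *m A; have aM := absmx_psd M.
have hM : psdmx2 (sandwich A K x 1) M (sandwich A K x 1).
  have := psdmx2_congr A A hN.
  by rewrite /sandwich (psdpow1 psdA) (psdmx_adj psdA).
have psdS := sandwich_psd x psdA psdK.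
have le1 := ltop_absmx_le k0 kn (psdS 1) hM.
apply: le_trans (ltop_sandwich_powR psdA psdK subK x0 k0 kn p_ge1).
have [V uV [_ l0 _]] := psdmx_lambda aM.
(* The power [p] acts on each ordered eigenvalue, so it comes out of the product; monotonicity of
   [powR] then leaves the comparison [le1] at exponent 1. *)
have -> : \prod_(j < k) lambda (psdpow (absmx M) p) j =
  powR (ltop k (absmx M)) p.
  rewrite /ltop -prod_powR => [|j]; last exact: (l0 (widen_ord kn j)).
  by apply: eq_bigr => j _; exact: (lambda_psdpow (widen_ord kn j) aM p0).
apply: (ge0_ler_powR p0 _ _ le1); rewrite nnegrE.
  exact: (ltop_ge0 kn aM).
exact: (ltop_ge0 kn (psdS 1)).
Qed.
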